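(* For all $n\ge 3$, $\mathrm{r}_n(1324)=5\cdot 2^{n-2}-4$.
   Context: $\mathcal{S}_n$ is the set of permutations of $[n]$, $\pi^r$ the reversal of $\pi$. A word $w$ contains $\rho\in\mathcal{S}_k$ if some subsequence $w_{i_1}\cdots w_{i_k}$ ($i_1<\cdots<i_k$) satisfies $w_{i_a}\le w_{i_b}$ iff $\rho_a\le\rho_b$; otherwise it avoids $\rho$. $\mathcal{R}_n=\{\pi\pi^r:\pi\in\mathcal{S}_n\}$ (concatenation of $\pi$ with its reversal), and $\mathrm{r}_n(\rho)$ is the number of members of $\mathcal{R}_n$ avoiding $\rho$. *)

(* Defs.v *)
From mathcomp Require Import all_boot.
Set Implicit Arguments.
Unset Strict Implicit.
Unset Printing Implicit Defensive.

(* Permutations are written in one-line notation, as words over the letters   *)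
(* 1, ..., n, so that S_n is [permutations (iota 1 n)].                       *)

Definition order_isomorphic (u rho : seq nat) : bool :=
  (size u == size rho) &&
  [forall a : 'I_(size rho), forall b : 'I_(size rho),
     (nth 0 u a <= nth 0 u b) == (nth 0 rho a <= nth 0 rho b)].

(* The subsequences of w are the words [mask m w] (see [subseqP]).            *)
Definition contains (w rho : seq nat) : bool :=
  [exists m : (size w).-tuple bool, order_isomorphic (mask m w) rho].

Definition avoids (w rho : seq nat) : bool := ~~ contains w rho.

Definition reverse_double_lists (n : nat) : seq (seq nat) :=
  [seq p ++ rev p | p <- permutations (iota 1 n)].

(* No word is listed twice, so [count] below does count distinct words.       *)
Lemma reverse_double_lists_uniq (n : nat) : uniq (reverse_double_lists n).
Proof.
rewrite map_inj_uniq ?permutations_uniq // => p q eq_pq.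
have /eqP : size (p ++ rev p) = size (q ++ rev q) by rewrite eq_pq.
rewrite !size_cat !size_rev !addnn => /eqP /double_inj eq_sz.
by move/eqP: eq_pq; rewrite eqseq_cat // => /andP[/eqP].
Qed.

Definition r (n : nat) (rho : seq nat) : nat :=
  count (fun w => avoids w rho) (reverse_double_lists n).

(* Main.v *)
(* Let [q] be the reversal of [p]. The word [p ++ rev p] avoids 1324 iff no     *)
(* three letters x, y, z read in this order in [q] satisfy z < x < y < n or     *)
(* 1 < y < x < z: the missing letter of 1324 can be taken to be n, resp. 1,     *)
(* which is available in both halves. If the head x of [q] lies strictly        *)
(* between the smallest and the largest letter of [2 .. n-1], these two produce *)
(* a forbidden triple in either order, so only 1, 2, n - 1 and n can be heads.  *)
(* With m = n - 2, counting by the head gives 2 ^ (m - 1) words on [2 .. n-1],  *)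
(* then 3 * 2 ^ (m - 1) - 1 words on [1 .. n-1] and, after reversing the order, *)
(* on [2 .. n]; a head n - 1 forces the tail to begin with n or with 1 n, and a *)
(* head 2 is symmetric.                                                         *)
Require Import Defs.
From mathcomp Require Import all_boot zify.

Set Implicit Arguments.
Unset Strict Implicit.
Unset Printing Implicit Defensive.

(** Let [q] be the reversal of the permutation, with l = 1, h = n and m = n - 2. In every forbidden
    triple of [q] the first letter lies strictly between the two later ones. So a head that is
    extremal among the remaining letters is free, while a head strictly between two letters of
    [2 .. n-1] is impossible ([nadm_mid]).

    Counting by heads, the interior letters admit 2^(m-1) words ([nadm_interior]); adding one bound
    gives 3 * 2^(m-1) - 1 ([nadm_above], [nadm_below]). With both bounds ([nadm_full]), heads 1 and
    n each leave such a word, and for m >= 2 heads 2 and n - 1 each contribute (3 * 2^(m-2) - 1) +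
    2^(m-2) = 2^m - 1 ([nadm_submin], [nadm_submax]), for a total of 5 * 2^m - 4. The link with 1324
    is [avoids_1324_reverse_double]. *)

(** * Triples, permutations by first letter, and subsequences *)

(** Splitting off the head separates the triples that start there from a smaller instance on the
    tail, which matches counting permutations by first letter. *)
Fixpoint triplewise (T : Type) (r3 : T -> T -> T -> bool) (s : seq T) : bool :=
  if s is x :: t then pairwise (r3 x) t && triplewise r3 t else true.

Lemma count_permutations_head (T : eqType) (Q : pred (seq T)) (s : seq T) :
  uniq s -> 0 < size s ->
  count Q (permutations s) =
  \sum_(x <- s) count (Q \o cons x) (permutations (rem x s)).
Proof.
move=> uniq_s s_gt0.
rewrite (permP (permutationsE s_gt0)) (undup_id uniq_s) count_flatten sumnE.
by rewrite !big_map; apply: eq_bigr => x _; rewrite count_map.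
Qed.

Lemma count_permutations_perm (T : eqType) (Q : pred (seq T)) (s t : seq T) :
  perm_eq s t -> count Q (permutations s) = count Q (permutations t).
Proof. by move=> eq_st; apply/permP/perm_permutations. Qed.

Lemma eq_count_permutations (T : eqType) (Q1 Q2 : pred (seq T)) (s : seq T) :
  (forall t, perm_eq t s -> Q1 t = Q2 t) ->
  count Q1 (permutations s) = count Q2 (permutations s).
Proof. by move=> eqQ; apply: eq_in_count => t; rewrite mem_permutations => /eqQ. Qed.

Lemma count_permutations0 (T : eqType) (Q : pred (seq T)) (s : seq T) :
  (forall t, perm_eq t s -> ~~ Q t) -> count Q (permutations s) = 0.
Proof.
move=> nQ; rewrite -(count_pred0 (permutations s)).
by apply: eq_count_permutations => t /nQ/negPf.
Qed.

Lemma pairwise_subseqP (T : eqType) (e : rel T) (s : seq T) :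
  reflect (forall y z, subseq [:: y; z] s -> e y z) (pairwise e s).
Proof.
elim: s => [|x s IH] /=; first by apply: ReflectT.
apply: (iffP andP) => [[/allP es /IH e2] y z|e2].
  by case: eqP => [-> | _]; rewrite ?sub1seq; [apply: es | apply: e2].
split; first by apply/allP => z zs; apply: e2; rewrite eqxx sub1seq.
apply/IH => y z yz; apply: e2; case: ifP => // _.
by apply: subseq_trans yz; apply: (suffix_subseq [:: y] [:: z]).
Qed.

Lemma triplewise_subseqP (T : eqType) (r3 : T -> T -> T -> bool) (s : seq T) :
  reflect (forall x y z, subseq [:: x; y; z] s -> r3 x y z) (triplewise r3 s).
Proof.
elim: s => [|w s IH] /=; first by apply: ReflectT.
apply: (iffP andP) => [[/pairwise_subseqP r2 /IH r3s] x y z|r3s].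
  by case: eqP => [-> | _]; [apply: r2 | apply: r3s].
split; first by apply/pairwise_subseqP => y z yz; apply: r3s; rewrite eqxx.
apply/IH => x y z xyz; apply: r3s; case: ifP => // _.
by apply: subseq_trans xyz; apply: (suffix_subseq [:: x] [:: y; z]).
Qed.

Lemma subseq2_total (T : eqType) (x y : T) (s : seq T) :
  x != y -> x \in s -> y \in s -> subseq [:: x; y] s || subseq [:: y; x] s.
Proof.
have cons2 u v w s' : subseq [:: u; v] (w :: s') =
    if u == w then v \in s' else subseq [:: u; v] s'.
  by rewrite -sub1seq /=; case: eqP.
move=> xy; elim: s => // w s IH; rewrite !inE !cons2.
case: (eqVneq x w) xy => [-> | _ _]; first by rewrite eq_sym => /negPf-> _ /= ->.
by case: (eqVneq y w) => [_ /= -> | _]; rewrite ?orbT.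
Qed.

(** Whichever of [b] and [c] is met first in [s] can be put in front of the other pair. *)
Lemma subseq2_interleave (T : eqType) (a b c d : T) (s : seq T) :
  b != c -> subseq [:: c; a] s -> subseq [:: b; d] s ->
  subseq [:: c; b; d] s || subseq [:: b; c; a] s.
Proof.
move=> bc; elim: s => // w s IH.
rewrite ![subseq _ (w :: s)]/=.
case: (eqVneq c w) => [cw | _]; first by rewrite -cw (negPf bc) => _ ->.
by case: (eqVneq b w) => [_ -> _ | _]; rewrite ?orbT.
Qed.

(* The bounds l and h need not occur in the word. Allowing arbitrary ones lets  *)
(* all the counts below share one predicate, and reversing R while exchanging l *)
(* and h swaps the two disjuncts.                                               *)
Definition admissible (T : Type) (R : rel T) (l h x y z : T) : bool :=
  ~~ ([&& R z x, R x y & R y h] || [&& R x z, R y x & R l y]).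

Definition nadm (T : eqType) (R : rel T) (l h : T) (s : seq T) : nat :=
  count (triplewise (admissible R l h)) (permutations s).

(** * Counting admissible words by their head, over an abstract strict order *)

Section StrictOrder.
Variables (T : eqType) (R : rel T).
Hypotheses (Rirr : irreflexive R) (Rtr : transitive R).
Implicit Types (l h a b x : T) (s t m : seq T).

Lemma Rasym x y : R x y -> R y x = false.
Proof. by move=> xy; apply/negP => /(Rtr xy); rewrite Rirr. Qed.

Lemma Rneq x y : R x y -> (x == y = false) * (y == x = false).
Proof. by move=> xy; split; apply/eqP => e; move: xy; rewrite e Rirr. Qed.

(** A forbidden triple needs one later letter on each side of its first letter, so an extremal head
    starts none. *)
Lemma admissible_min l h x t : all (R x) t -> pairwise (admissible R l h x) t.
Proof.
move=> /allP xt; apply/pairwise_subseqP => y z /mem_subseq yz.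
have /xt/Rasym xy : y \in t by apply: yz; rewrite !inE eqxx.
have /xt/Rasym xz : z \in t by apply: yz; rewrite !inE eqxx orbT.
by rewrite /admissible xy xz /= andbF.
Qed.

Lemma admissible_max l h x t : all (R^~ x) t -> pairwise (admissible R l h x) t.
Proof.
move=> /allP xt; apply/pairwise_subseqP => y z /mem_subseq yz.
have /xt/Rasym xy : y \in t by apply: yz; rewrite !inE eqxx.
have /xt/Rasym xz : z \in t by apply: yz; rewrite !inE eqxx orbT.
by rewrite /admissible xy xz /= andbF.
Qed.

Lemma nadm_min l h x s : all (R x) s ->
  count (triplewise (admissible R l h) \o cons x) (permutations s) = nadm R l h s.
Proof.
move=> xs; apply: eq_count_permutations => t ts /=.
by rewrite admissible_min // (perm_all _ ts).
Qed.

Lemma nadm_max l h x s : all (R^~ x) s ->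
  count (triplewise (admissible R l h) \o cons x) (permutations s) = nadm R l h s.
Proof.
move=> xs; apply: eq_count_permutations => t ts /=.
by rewrite admissible_max // (perm_all _ ts).
Qed.

(** Both [a] and [b] follow the head: in the order [a], [b] the second forbidden pattern appears, in
    the order [b], [a] the first. *)
Lemma nadm_mid l h a b x s : R l a -> R a x -> R x b -> R b h ->
  a \in s -> b \in s ->
  count (triplewise (admissible R l h) \o cons x) (permutations s) = 0.
Proof.
move=> la ax xb bh as_ bs; apply: count_permutations0 => t /perm_mem ts /=.
rewrite negb_and; apply/orP; left; apply/negP => /pairwise_subseqP adm.
have ab : a != b by rewrite (Rneq (Rtr ax xb)).
case/orP: (subseq2_total ab (etrans (ts a) as_) (etrans (ts b) bs)) => /adm.
  by rewrite /admissible ax xb la orbT.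
by rewrite /admissible ax xb bh.
Qed.

Lemma nadm_perm l h s t : perm_eq s t -> nadm R l h s = nadm R l h t.
Proof. exact: count_permutations_perm. Qed.

Lemma nadm1 l h x : nadm R l h [:: x] = 1.
Proof. by rewrite /nadm count_permutations_head //= big_seq1 /= eqxx. Qed.

Lemma pairwise_ends l h a b m : pairwise R (l :: rcons (a :: rcons m b) h) ->
  [/\ [/\ R l a, R l b, R l h & R a b], [/\ R a h, R b h & uniq [:: l, h, a, b & m]],
      [/\ all (R l) m, all (R a) m, all (R^~ b) m & all (R^~ h) m],
      pairwise R (l :: rcons (a :: m) h) & pairwise R (l :: rcons (rcons m b) h)].
Proof.
move=> sorted; have := pairwise_uniq Rirr sorted.
have p : perm_eq (l :: rcons (a :: rcons m b) h) [:: l, h, a, b & m].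
  by rewrite perm_cons perm_rcons !perm_cons perm_rcons.
rewrite (perm_uniq p); move: sorted.
rewrite [in X in X -> _]/= !all_rcons !pairwise_rcons !all_rcons [in X in X -> _]/=.
case/and5P => /and4P[la lh lb lm] /and3P[ah ab am] /andP[bh mh] mb mm Um.
by rewrite /= !all_rcons !pairwise_rcons !all_rcons la lh lb lm ah ab am bh mh mb mm.
Qed.

(** Only the least and the greatest letter can be heads, and each leaves an interior word with one
    letter fewer, so the count doubles. *)
Lemma nadm_interior l h s : pairwise R (l :: rcons s h) -> 0 < size s ->
  nadm R l h s = 2 ^ (size s).-1.
Proof.
have [n] := ubnP (size s); elim: n s => // n IH [//|a s].
case/lastP: s => [_ _ _|m b]; first exact: nadm1.
rewrite /= size_rcons ltnS => sz /pairwise_ends.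
case=> -[la lb lh ab] [ah bh U] [lm am mb mh] sm sb _.
have p : perm_eq (a :: rcons m b) [:: a, b & m] by rewrite perm_cons perm_rcons.
rewrite (nadm_perm _ _ p) /nadm count_permutations_head ?(subseq_uniq _ U) //; last first.
  exact: (suffix_subseq [:: l; h]).
rewrite !big_cons /= eqxx (Rneq ab) eqxx.
rewrite nadm_min ?nadm_max /= ?ab ?mb ?am //.
rewrite big1_seq ?addn0 => [|x /andP[_ xm]]; last first.
  have [ax xb] := (allP am _ xm, allP mb _ xm).
  by rewrite !(Rneq ax) !(Rneq xb) (nadm_mid la ax xb bh) // !inE eqxx ?orbT.
have p' : perm_eq (b :: m) (rcons m b) by rewrite perm_sym perm_rcons.
by rewrite (nadm_perm _ _ p') !IH ?size_rcons //= addnn -mul2n -expnS.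
Qed.

(** Three heads survive: [l] leaves an interior word, the greatest letter leaves the same problem
    one letter shorter, and the least interior letter [a] must be followed by [l]. The successor
    form avoids truncated subtraction. *)
Lemma nadm_above l h s : pairwise R (l :: rcons s h) -> 0 < size s ->
  (nadm R l h (l :: s)).+1 = 3 * 2 ^ (size s).-1.
Proof.
have [n] := ubnP (size s); elim: n s => // n IH [//|a s].
case/lastP: s => [_ |m b].
  rewrite /= !andbT => /andP[/andP[la _] _] _.
  rewrite /nadm count_permutations_head /= ?inE ?(Rneq la) // !big_cons big_nil /=.
  by rewrite eqxx (Rneq la) eqxx nadm_min ?nadm_max ?nadm1 //= la.
move=> + sorted _; rewrite /= size_rcons ltnS => sz.
have [[la lb lh ab] [ah bh U] [lm am mb mh] sm sb] := pairwise_ends sorted.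
have p : perm_eq (a :: rcons m b) [:: a, b & m] by rewrite perm_cons perm_rcons.
have pl : perm_eq (l :: a :: rcons m b) [:: l, a, b & m] by rewrite perm_cons.
have pm : perm_eq (b :: m) (rcons m b) by rewrite perm_sym perm_rcons.
have Ul : uniq [:: l, a, b & m].
  apply: subseq_uniq U.
  exact: (cat_subseq (prefix_subseq [:: l] [:: h]) (subseq_refl [:: a, b & m])).
have UM : uniq [:: l, b & m].
  apply: subseq_uniq Ul.
  exact: (cat_subseq (prefix_subseq [:: l] [:: a]) (subseq_refl [:: b & m])).
rewrite (nadm_perm _ _ pl) /nadm count_permutations_head //.
rewrite !big_cons /= eqxx !(Rneq la) eqxx !(Rneq lb) !(Rneq ab) eqxx.
rewrite (nadm_min l h (x := l)) /= ?la ?lb ?lm //.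
rewrite (nadm_max l h (x := b)) /= ?ab ?lb ?mb //.
rewrite -(nadm_perm _ _ p).
rewrite big1_seq ?addn0 => [|x /andP[_ xm]]; last first.
  have [[lx ax] xb] := (allP lm _ xm, allP am _ xm, allP mb _ xm).
  by rewrite !(Rneq lx) !(Rneq ax) !(Rneq xb) (nadm_mid la ax xb bh) // !inE eqxx ?orbT.
(* After the head [a], any letter [x] preceding [l] would give the triple [a], [x], [l] with [l]
   below [a], [a] below [x] and [x] below [h]. So [l] comes next, and it is free. *)
suff -> : count (triplewise (admissible R l h) \o cons a) (permutations [:: l, b & m])
          = nadm R l h (rcons m b).
  have F := IH (a :: m) sz sm isT; have E1 := nadm_interior sorted isT.
  have := nadm_interior sb; rewrite size_rcons => /(_ isT) E2.
  move: F E1 E2; rewrite /= size_rcons expnS; clear.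
  move: (nadm R l h _) (nadm R l h _) (nadm R l h _) (2 ^ _) => *; lia.
rewrite count_permutations_head // big_cons /= eqxx.
rewrite big1_seq ?addn0 => [|x /andP[_ xm]]; last first.
  have lx : R l x by move: xm; rewrite inE => /orP[/eqP-> //|/(allP lm)].
  have ax : R a x by move: xm; rewrite inE => /orP[/eqP-> //|/(allP am)].
  have xh : R x h by move: xm; rewrite inE => /orP[/eqP-> //|/(allP mh)].
  rewrite !(Rneq lx); apply: count_permutations0 => t /perm_mem ts /=.
  rewrite !negb_and -!orbA; apply/orP; left; apply/allPn; exists l; first by rewrite ts mem_head.
  by rewrite /admissible negbK la ax xh.
rewrite -(nadm_perm _ _ pm); apply: eq_count_permutations => t ts.
have [mt mlt] : all (R a) t /\ all (R l) t by rewrite !(perm_all _ ts) /= ab am lb lm.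
rewrite /= !admissible_min //= andbT; apply/andb_idl => _; apply/allP => z _.
by rewrite /admissible Rirr (Rasym la) /= !andbF.
Qed.

End StrictOrder.

(** * Symmetry under reversal of the order *)

Lemma triplewise_admissible_flip (T : Type) (R : rel T) (l h : T) :
  triplewise (admissible (fun x y => R y x) h l) =1 triplewise (admissible R l h).
Proof.
elim=> //= x t ->; congr (_ && _).
by apply: eq_pairwise => y z; rewrite /admissible orbC.
Qed.

Lemma nadm_flip (T : eqType) (R : rel T) (l h : T) (s : seq T) :
  nadm (fun x y => R y x) h l s = nadm R l h s.
Proof. exact/eq_count/triplewise_admissible_flip. Qed.

Lemma pairwise_flip (T : Type) (R : rel T) (s : seq T) :
  pairwise (fun x y => R y x) (rev s) = pairwise R s.
Proof. by elim: s => //= x s IH; rewrite rev_cons pairwise_rcons IH all_rev. Qed.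

Lemma nadm_below (T : eqType) (R : rel T) (l h : T) (s : seq T) :
  irreflexive R -> transitive R ->
  pairwise R (l :: rcons s h) -> 0 < size s ->
  (nadm R l h (rcons s h)).+1 = 3 * 2 ^ (size s).-1.
Proof.
move=> Rirr Rtr sorted sz; rewrite -nadm_flip.
have p : perm_eq (rcons s h) (h :: rev s) by rewrite perm_rcons perm_cons perm_sym perm_rev.
rewrite (nadm_perm _ _ _ p) nadm_above ?size_rev //.
- by move=> y x z xy yz; apply: Rtr xy.
by rewrite -rev_cons -rev_rcons pairwise_flip.
Qed.

(** * Words containing both bounds *)

(** No letter of [s] may precede [h] after the head [b], since [b], [x], [h] would be forbidden. So
    the tail is [h] followed by a word on [l :: s], or [l], [h] followed by a word on [s]; these
    prefixes create no forbidden triple. *)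
Lemma nadm_submax (T : eqType) (R : rel T) (l h b : T) (s : seq T) :
  irreflexive R -> transitive R -> pairwise R (l :: rcons (rcons s b) h) ->
  count (triplewise (admissible R l h) \o cons b) (permutations [:: l, h & s])
  = nadm R l h (l :: s) + nadm R l h s.
Proof.
move=> Rirr Rtr sorted.
have := pairwise_uniq Rirr sorted; move: sorted.
rewrite /= !all_rcons !pairwise_rcons !all_rcons.
case/and4P => /and3P[lh lb ls] /andP[bh sh] sb _.
rewrite !(mem_rcons, rcons_uniq, inE, negb_or).
case/and4P => /and3P[_ _ nls] /andP[_ nhs] _ Us.
have Ul : uniq [:: l, h & s] by rewrite /= !inE (Rneq Rirr lh) negb_or /= nls nhs.
have adm_h t : admissible R l h b h t.
  by rewrite /admissible Rirr (Rasym Rirr Rtr bh) /= !andbF.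
have not_h_after t x : R l x -> R x b -> h \in t ->
    ~~ pairwise (admissible R l h b) (x :: t).
  move=> lx xb ht; rewrite /= negb_and; apply/orP; left; apply/allPn; exists h => //.
  by rewrite /admissible negbK lx xb bh orbT.
rewrite count_permutations_head // !big_cons /= eqxx (Rneq Rirr lh) eqxx.
rewrite big1_seq ?addn0 => [|x /andP[_ xs]]; last first.
  have [[lx xb] xh] := (allP ls _ xs, allP sb _ xs, allP sh _ xs).
  rewrite !(Rneq Rirr lx) !(Rneq Rirr xh); apply: count_permutations0 => t /perm_mem ts.
  by rewrite /= negb_and not_h_after // ts !inE eqxx orbT.
rewrite addnC; congr (_ + _).
  apply: eq_count_permutations => t ts /=.
  have tb : all (R^~ b) t by rewrite (perm_all _ ts) /= lb.
  have th : all (R^~ h) t by rewrite (perm_all _ ts) /= lh.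
  have -> : all (admissible R l h b h) t by apply/allP.
  by rewrite !admissible_max.
have Uhs : uniq (h :: s) by rewrite /= nhs.
rewrite count_permutations_head // big_cons /= eqxx.
rewrite big1_seq ?addn0 => [|x /andP[_ xs]]; last first.
  have [[lx xb] xh] := (allP ls _ xs, allP sb _ xs, allP sh _ xs).
  rewrite !(Rneq Rirr xh); apply: count_permutations0 => t /perm_mem ts.
  have := not_h_after t x lx xb; rewrite ts mem_head => /(_ isT) /=.
  by rewrite !negb_and => /orP[] ->; rewrite ?orbT.
apply: eq_count_permutations => t ts /=.
have tb : all (R^~ b) t by rewrite (perm_all _ ts).
have th : all (R^~ h) t by rewrite (perm_all _ ts).
have tl : all (R l) t by rewrite (perm_all _ ts).
have -> : all (admissible R l h b h) t by apply/allP.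
have adm_l z : admissible R l h b l z.
  by rewrite /admissible Rirr (Rasym Rirr Rtr lb) /= !andbF.
have -> : all (admissible R l h b l) t by apply/allP.
rewrite adm_l !(admissible_max _ _ _ _ tb) // !(admissible_max _ _ _ _ th) //.
have tlh : all (R l) (h :: t) by rewrite /= lh.
by have /= -> := admissible_min Rirr Rtr l h tlh.
Qed.

(** Mirror image of [nadm_submax]: in the reversed order [l] and [h] trade places and [a] becomes
    the letter next to the top. *)
Lemma nadm_submin (T : eqType) (R : rel T) (l h a : T) (s : seq T) :
  irreflexive R -> transitive R -> pairwise R [:: l, a & rcons s h] ->
  count (triplewise (admissible R l h) \o cons a) (permutations [:: l, h & s])
  = nadm R l h (rcons s h) + nadm R l h s.
Proof.
move=> Rirr Rtr sorted.
have p : perm_eq [:: l, h & s] [:: h, l & rev s].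
  by rewrite (perm_catCA [:: l] [:: h] s) !perm_cons perm_sym perm_rev.
have q : perm_eq (rcons s h) (h :: rev s).
  by rewrite perm_rcons perm_cons perm_sym perm_rev.
have rev_s : perm_eq s (rev s) by rewrite perm_sym perm_rev.
rewrite (nadm_perm _ _ _ q) (nadm_perm _ _ _ rev_s) (count_permutations_perm _ p).
rewrite -!(nadm_flip R) -(@nadm_submax _ (fun x y => R y x) h l a) //.
- by apply: eq_count => t; rewrite [RHS](triplewise_admissible_flip R l h (a :: t)).
- by move=> y x z xy yz; apply: Rtr xy.
by rewrite -rev_cons -rcons_cons -rev_rcons -rev_cons pairwise_flip.
Qed.

Lemma nadm_full (T : eqType) (R : rel T) (l h : T) (s : seq T) :
  irreflexive R -> transitive R -> pairwise R (l :: rcons s h) -> 0 < size s ->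
  nadm R l h (l :: rcons s h) = 5 * 2 ^ size s - 4.
Proof.
move=> Rirr Rtr; case: s => // a s; case/lastP: s => [sorted _|m b sorted _].
  have [lh ah la] : [/\ R l h, R a h & R l a].
    by move: sorted; rewrite /= !andbT => /andP[/andP[-> ->] ->].
  have p : perm_eq [:: l; a; h] [:: l; h; a] by rewrite perm_cons -(perm_rot 1).
  rewrite (nadm_perm _ _ _ p) /nadm count_permutations_head //; last first.
    by rewrite /= !inE !(Rneq Rirr lh) (Rneq Rirr ah) (Rneq Rirr la).
  rewrite !big_cons big_nil /= !eqxx !(Rneq Rirr lh) !(Rneq Rirr ah) (Rneq Rirr la) ?eqxx.
  rewrite (nadm_min Rirr Rtr l h (x := l)) /= ?lh ?la //.
  rewrite (nadm_max Rirr Rtr l h (x := h)) /= ?lh ?ah //.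
  (* A single interior letter is next to both bounds at once, so it is counted as one head,
     contributing 1 + 1. *)
  rewrite (nadm_submax (s := [::])) // nadm1 [nadm _ _ _ [::]]/nadm.
  have := nadm_above Rirr Rtr sorted isT; have := nadm_below Rirr Rtr sorted isT.
  have p' : perm_eq [:: h; a] (rcons [:: a] h) by rewrite perm_sym -(perm_rot 1).
  by rewrite (nadm_perm _ _ _ p') /= => -[->] [->].
have [[la lb lh ab] [ah bh U] [lm am mb mh] sm sb] := pairwise_ends Rirr sorted.
have p : perm_eq (l :: rcons (a :: rcons m b) h) [:: l, h, a, b & m].
  by rewrite perm_cons perm_rcons !perm_cons perm_rcons.
have pt : perm_eq [:: h, a, b & m] (rcons (a :: rcons m b) h).
  by rewrite perm_sym; move: p; rewrite perm_cons.
have pb : perm_eq [:: l, a, b & m] (l :: a :: rcons m b).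
  by rewrite !perm_cons perm_sym perm_rcons.
have pa : perm_eq [:: l, h, b & m] [:: l, h & rcons m b].
  by rewrite !perm_cons perm_sym perm_rcons.
rewrite (nadm_perm _ _ _ p) /nadm count_permutations_head //.
rewrite !big_cons /= eqxx !(Rneq Rirr lh) !(Rneq Rirr la) !(Rneq Rirr lb).
rewrite !(Rneq Rirr ah) !(Rneq Rirr bh) !(Rneq Rirr ab) !eqxx.
rewrite big1_seq ?addn0 => [|x /andP[_ xm]]; last first.
  have [[lx ax] [xb xh]] := (allP lm _ xm, allP am _ xm, (allP mb _ xm, allP mh _ xm)).
  rewrite !(Rneq Rirr lx) !(Rneq Rirr ax) !(Rneq Rirr xb) !(Rneq Rirr xh).
  by rewrite (nadm_mid Rirr Rtr la ax xb bh) // !inE eqxx ?orbT.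
rewrite (nadm_min Rirr Rtr l h (x := l)) /= ?lh ?la ?lb //.
rewrite (nadm_max Rirr Rtr l h (x := h)) /= ?lh ?ah ?bh //.
rewrite (count_permutations_perm _ pa) nadm_submin // nadm_submax //.
rewrite (nadm_perm _ _ _ pt) (nadm_perm _ _ _ pb).
have := nadm_above Rirr Rtr sorted isT; have := nadm_below Rirr Rtr sorted isT.
have := nadm_above Rirr Rtr sm isT; have := nadm_interior Rirr Rtr sm isT.
have := nadm_below Rirr Rtr sb; have := nadm_interior Rirr Rtr sb.
rewrite !size_rcons => /(_ isT) + /(_ isT); rewrite /= !size_rcons /= !expnS; clear.
move: (nadm R l h _) (nadm R l h _) (nadm R l h _) (nadm R l h _) (2 ^ _).
move: (nadm R l h _) (nadm R l h _) => *; lia.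
Qed.

(** * From occurrences of 1324 to forbidden triples *)

Lemma order_isomorphic_1324 (a b c d : nat) :
  order_isomorphic [:: a; c; b; d] [:: 1; 3; 2; 4] = [&& a < b, b < c & c < d].
Proof.
rewrite /order_isomorphic eqxx /=; apply/idP/idP.
  move=> /forallP iso; pose o i lt4 := Ordinal (n := 4) (m := i) lt4.
  have := iso (o 2 isT) => /forallP/(_ (o 0 isT))/eqP /=.
  have := iso (o 1 isT) => /forallP iso1.
  have := iso1 (o 2 isT) => /eqP /=.
  have := iso (o 3 isT) => /forallP/(_ (o 1 isT))/eqP /=.
  by rewrite !ltnNge => -> -> ->.
case/and3P => ab bc cd; apply/forallP => -[i lti]; apply/forallP => -[j ltj] /=.
by case: i j lti ltj => [|[|[|[|i]]]] [|[|[|[|j]]]] //= _ _; apply/eqP; lia.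
Qed.

Lemma contains_1324P (w : seq nat) :
  reflect (exists a b c d, subseq [:: a; c; b; d] w /\ [&& a < b, b < c & c < d])
          (contains w [:: 1; 3; 2; 4]).
Proof.
apply: (iffP existsP) => [[m iso] | [a [b [c [d [/subseqP[m sz eq_m] abcd]]]]]].
  have sub := mask_subseq m w; move: (iso) sub; case/andP: iso => /eqP + _.
  case: (mask m w) => [|a [|c [|b [|d [|]]]]] //= _.
  by rewrite order_isomorphic_1324 => abcd sub; exists a, b, c, d.
by exists (Tuple (introT eqP sz)); rewrite /= -eq_m order_isomorphic_1324.
Qed.

Lemma subseq_catP (T : eqType) (s u v : seq T) :
  reflect (exists s1 s2, [/\ s = s1 ++ s2, subseq s1 u & subseq s2 v])
          (subseq s (u ++ v)).
Proof.
apply: (iffP idP) => [/subseqP[m] | [s1 [s2 [-> s1u s2v]]]]; last exact: cat_subseq.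
rewrite size_cat => sz ->; rewrite -(cat_take_drop (size u) m) mask_cat; last first.
  by rewrite size_takel // sz leq_addr.
by exists (mask (take (size u) m) u), (mask (drop (size u) m) v); rewrite !mask_subseq.
Qed.

Lemma avoids_1324_reverse_double (n : nat) (p : seq nat) : perm_eq p (iota 1 n) ->
  avoids (p ++ rev p) [:: 1; 3; 2; 4] = triplewise (admissible ltn 1 n) (rev p).
Proof.
move=> pn; have mem_q x : (x \in rev p) = (0 < x <= n).
  by rewrite mem_rev (perm_mem pn) mem_iota add1n ltnS.
have sub_p s : subseq s p = subseq (rev s) (rev p) by rewrite subseq_rev.
apply/idP/idP => [av | /triplewise_subseqP adm].
  apply/triplewise_subseqP => x y z xyz; apply: contraNT av => /negPn.
  have /allP q_mem : all [in rev p] [:: x; y; z] by apply/allP => w /(mem_subseq xyz).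
  have [xq yq zq] : [/\ x \in rev p, y \in rev p & z \in rev p].
    by split; apply: q_mem; rewrite !inE eqxx ?orbT.
  move: xq yq zq; rewrite !mem_q => /andP[x0 xn] /andP[y0 yn] /andP[z0 zn].
  case/orP => /and3P[h1 h2 h3]; apply/contains_1324P.
    (* The first half reads [z], [y], [x], an occurrence of 132, and the second half supplies [n] as
       the 4. The other case takes 1 from the first half. *)
    exists z, x, y, n; split; last by apply/and3P.
    apply/subseq_catP; exists [:: z; y; x], [:: n].
    by rewrite sub_p sub1seq mem_q leqnn (leq_trans x0 xn).
  exists 1, y, x, z; split; last by apply/and3P.
  apply/subseq_catP; exists [:: 1], [:: x; y; z].
  by rewrite sub_p sub1seq mem_q (leq_trans x0 xn).
apply/negP => /contains_1324P[a [b [c [d [/subseq_catP[s1 [s2 [eq_s]]]]]]]].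
rewrite sub_p => sub1 sub2 /and3P[ab bc cd].
have high x y z w : w \in rev p -> subseq [:: x; y; z] (rev p) -> z < x -> x < y -> y < w -> False.
  rewrite mem_q => /andP[_ wn] /adm /negP nadm zx xy yw; apply: nadm.
  by apply/orP; left; apply/and3P; split=> //; apply: leq_trans wn.
have low x y z w : w \in rev p -> subseq [:: x; y; z] (rev p) -> x < z -> y < x -> w < y -> False.
  rewrite mem_q => /andP[w0 _] /adm /negP nadm xz yx wy; apply: nadm.
  by apply/orP; right; apply/and3P; split=> //; apply: leq_trans wy.
(* Split by how many letters of the occurrence lie in the first half. With at most one, [c], [b],
   [d] is read in [rev p]; with at least three, [b], [c], [a] is. With two, the pairs [c], [a] and
   [b], [d] both lie in [rev p], and interleaving them yields one of these triples. *)
case: s1 => [|s [|s' [|s'' [|s''' s1]]]] in eq_s sub1.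
- move: sub2; rewrite -(eq_s : _ = s2) => sub2.
  have in_a : a \in rev p by apply: (mem_subseq sub2); rewrite mem_head.
  apply: (low c b d a) => //; apply: subseq_trans sub2.
  by rewrite (subseq_cons [:: c; b; d] a).
- case: eq_s sub1 sub2 => <- <-; rewrite sub1seq => in_a sub2.
  exact: (low c b d a).
- case: eq_s sub1 sub2 => <- <- <- sub1 sub2.
  have in_a : a \in rev p by apply: (mem_subseq sub1); rewrite !inE eqxx orbT.
  have in_d : d \in rev p by apply: (mem_subseq sub2); rewrite !inE eqxx orbT.
  have bnc : b != c by rewrite neq_ltn bc.
  case/orP: (subseq2_interleave bnc sub1 sub2) => sub.
    exact: (low c b d a).
  exact: (high b c a d).
- case: eq_s sub1 sub2 => <- <- <- <- sub1; rewrite sub1seq => in_d.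
  exact: (high b c a d).
case: eq_s sub1 => <- <- <- <- _ sub1.
have in_d : d \in rev p by apply: (mem_subseq sub1); rewrite mem_rev !inE eqxx !orbT.
apply: (high b c a d) => //; apply: subseq_trans sub1.
by rewrite -[[:: b; c; a]]/(rev [:: a; c; b]) subseq_rev (prefix_subseq [:: a; c; b]).
Qed.

Lemma count_rev_permutations (T : eqType) (Q : pred (seq T)) (s : seq T) :
  count (Q \o rev) (permutations s) = count Q (permutations s).
Proof.
rewrite -count_map; apply/permP/uniq_perm; rewrite ?permutations_uniq //.
  by rewrite (map_inj_uniq (can_inj revK)) permutations_uniq.
move=> t; rewrite mem_permutations; apply/mapP/idP => [[u + ->]|ts].
  by rewrite mem_permutations perm_rev.
by exists (rev t); rewrite ?revK // mem_permutations perm_rev.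
Qed.

Theorem theorem10 (n : nat) (hn : 3 <= n) :
  r n [:: 1; 3; 2; 4] = 5 * 2 ^ (n - 2) - 4.
Proof.
have iota_ends : iota 1 n = 1 :: rcons (iota 2 (n - 2)) n.
  case: n hn => [|[|n]] // _; rewrite subn2 -cats1 -[in RHS]add2n.
  by rewrite -[[:: 2 + n]]/(iota (2 + n) 1) -iotaD addn1.
rewrite /r /reverse_double_lists count_map.
have -> : count (preim (fun p => p ++ rev p) (avoids^~ [:: 1; 3; 2; 4]))
                (permutations (iota 1 n)) = nadm ltn 1 n (iota 1 n).
  (* The triple condition bears on [rev p]; reversal permutes the permutations, so the count is
     unchanged. *)
  rewrite /nadm -count_rev_permutations; apply: eq_count_permutations => p pn.
  exact: avoids_1324_reverse_double.
rewrite iota_ends nadm_full ?size_iota ?subn_gt0 //; first exact: ltnn.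
- exact: ltn_trans.
by rewrite -iota_ends -sorted_pairwise ?iota_ltn_sorted //; apply: ltn_trans.
Qed.
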